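(* Let $D$ be a finite distributive lattice and let $G$ be an abelian group. Then every lattice homomorphism $\varphi\colon D\to\operatorname{Sub}G$ satisfying the purity condition is purely finitely approximated.
   Context: $\operatorname{Sub}G$ is the lattice of all subgroups of $G$ ordered by inclusion (join is sum, meet is intersection). Lattice homomorphisms preserve binary joins and meets, and are not required to preserve the least or largest element. A map $\varphi\colon D\to\operatorname{Sub}G$ satisfies the purity condition if for all $u\le v$ in $D$, $\varphi(u)$ is a pure subgroup of $\varphi(v)$. A lattice homomorphism $\varphi\colon D\to\operatorname{Sub}G$ satisfying the purity condition is purely finitely approximated if for every finitely generated subgroup $H$ of $G$ there exists a lattice homomorphism $\psi\colon D\to\operatorname{Sub}G$ satisfying the purity condition such that, for all $u\in D$, $\psi(u)$ is finitely generated and $H\cap\varphi(u)\subseteq\psi(u)\subseteq\varphi(u)$. *)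

(* Defs.v *)
From HB Require Import structures.
From mathcomp Require Import all_boot all_order all_algebra.
From mathcomp Require Import boolp classical_sets.

Set Implicit Arguments.
Unset Strict Implicit.
Unset Printing Implicit Defensive.

Import Order.TTheory GRing.Theory.
Local Open Scope classical_set_scope.
Local Open Scope ring_scope.

Fact subgroup_display : Order.disp_t. Proof. exact: Order.Disp tt tt. Qed.

(* The closure condition is a boolean so that [subgroup G] is a subtype of
   [set G]: subgroups with the same elements are then equal. *)
Record subgroup (G : zmodType) := Subgroup {
  carrier :> set G;
  carrier_closed : `[< zmod_closed (mem carrier) >] }.

HB.instance Definition _ (G : zmodType) := [isSub for @carrier G].
HB.instance Definition _ (G : zmodType) := [Choice of subgroup G by <:].
HB.instance Definition _ (G : zmodType) :=
  Order.SubChoice_isSubPOrder.Build _ (set G) _ subgroup_display (subgroup G).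

Section SubgroupLattice.
Variable G : zmodType.
Implicit Types A B C : subgroup G.

Lemma le_subgroupP A B : reflect (carrier A `<=` carrier B) (A <= B)%O.
Proof. by apply: (iffP (asboolP _)). Qed.

Lemma eq_subgroup A B : (forall x, carrier A x <-> carrier B x) -> A = B.
Proof. by move=> AB; apply/val_inj/seteqP; split=> x /AB. Qed.

Lemma zmod_closedP (A : set G) :
  zmod_closed (mem A) <-> A 0 /\ (forall x y, A x -> A y -> A (x - y)).
Proof.
split=> -[A0 AB]; split.
- by move: A0; rewrite in_setE.
- by move=> x y Ax Ay; apply/set_mem/AB; apply/mem_set.
- exact/mem_set.
- by move=> x y /set_mem Ax /set_mem Ay; apply/mem_set/AB.
Qed.

Lemma subgroup0 A : carrier A 0.
Proof. by have /asboolP/zmod_closedP[] := carrier_closed A. Qed.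

Lemma subgroupB A x y : carrier A x -> carrier A y -> carrier A (x - y).
Proof. by have /asboolP/zmod_closedP[_] := carrier_closed A; apply. Qed.

Lemma subgroupN A x : carrier A x -> carrier A (- x).
Proof. by rewrite -[- x]sub0r; apply: subgroupB; exact: subgroup0. Qed.

Lemma subgroupD A x y : carrier A x -> carrier A y -> carrier A (x + y).
Proof.
by move=> Ax Ay; rewrite -[y]opprK; apply: subgroupB => //; exact: subgroupN.
Qed.

Fact cap_closed A B : `[< zmod_closed (mem (carrier A `&` carrier B)) >].
Proof.
apply/asboolP/zmod_closedP; split; first by split; exact: subgroup0.
by move=> x y [Ax Bx] [Ay By]; split; exact: subgroupB.
Qed.

Fact sum_closed A B :
  `[< zmod_closed (mem [set a + b | a in carrier A & b in carrier B]) >].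
Proof.
apply/asboolP/zmod_closedP; split.
  by exists 0; [exact: subgroup0|exists 0; [exact: subgroup0|rewrite addr0]].
move=> _ _ [a Aa [b Bb <-]] [a' Aa' [b' Bb' <-]].
exists (a - a'); first exact: subgroupB.
by exists (b - b'); [exact: subgroupB|rewrite opprD addrACA].
Qed.

Definition cap_subgroup A B : subgroup G := Subgroup (cap_closed A B).
Definition sum_subgroup A B : subgroup G := Subgroup (sum_closed A B).

Fact cap_subgroupP A B C : (A <= cap_subgroup B C)%O = (A <= B)%O && (A <= C)%O.
Proof.
apply/le_subgroupP/andP => [ABC|[/le_subgroupP AB /le_subgroupP AC] x Ax].
  by split; apply/le_subgroupP => x /ABC[].
by split; [exact: AB|exact: AC].
Qed.

Fact sum_subgroupP A B C : (sum_subgroup A B <= C)%O = (A <= C)%O && (B <= C)%O.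
Proof.
apply/le_subgroupP/andP =>
  [ABC|[/le_subgroupP AC /le_subgroupP BC] _ [a Aa [b Bb <-]]].
  split; apply/le_subgroupP => x xS; apply: ABC.
    by exists x => //; exists 0; [exact: subgroup0|rewrite addr0].
  by exists 0; [exact: subgroup0|exists x => //; rewrite add0r].
by apply: subgroupD; [exact: AC|exact: BC].
Qed.

HB.instance Definition _ :=
  Order.POrder_MeetJoin_isLattice.Build subgroup_display (subgroup G)
    cap_subgroupP sum_subgroupP.

Lemma meet_subgroupE A B : carrier (A `&` B)%O = carrier A `&` carrier B.
Proof. by []. Qed.

Lemma join_subgroupE A B :
  carrier (A `|` B)%O = [set a + b | a in carrier A & b in carrier B].
Proof. by []. Qed.

End SubgroupLattice.

Definition finitely_generated (G : zmodType) (A : subgroup G) : Prop :=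
  exists s : seq G,
    carrier A = smallest (fun X : set G => zmod_closed (mem X)) [set` s].

Definition pure_in (G : zmodType) (A B : subgroup G) : Prop :=
  (A <= B)%O /\
  forall (n : nat) (b : G), carrier B b -> carrier A (b *+ n) ->
    exists2 a : G, carrier A a & a *+ n = b *+ n.

Definition purity_condition (d : Order.disp_t) (D : finDistrLatticeType d)
    (G : zmodType) (phi : D -> subgroup G) : Prop :=
  forall u v : D, (u <= v)%O -> pure_in (phi u) (phi v).

Definition purely_finitely_approximated (d : Order.disp_t)
    (D : finDistrLatticeType d) (G : zmodType)
    (phi : {lmorphism D -> subgroup G}) : Prop :=
  forall H : subgroup G, finitely_generated H ->
  exists psi : {lmorphism D -> subgroup G},
    purity_condition psi /\
    forall u : D, finitely_generated (psi u) /\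
      (H `&` phi u <= psi u <= phi u)%O.

(* Main.v *)
Require Import Defs.
From HB Require Import structures.
From mathcomp Require Import all_boot all_order all_algebra.
From mathcomp Require Import boolp classical_sets.

(** Why the theorem holds.

    For each [u] let [below u] be the sum of all [phi v] with [v < u].  It is
    either zero ([u] minimal) or [phi w] for the join [w] of the elements strictly
    below [u], so by the purity condition it is pure in [phi u].  Over a pure
    subgroup, finitely generated extensions split ([pure_complement]): modulo
    the pure subgroup a finitely generated group is a direct sum of cyclic
    groups, and purity lifts each cyclic summand to one of the same order.

    Choose finitely generated subgroups [C u] of [phi u] that meet [below u]
    only in zero, and let [psi u] be the sum of all [C w] with [w <= u].  Whatever
    the choice, distributivity of [D] makes the family [C] independent
    ([complements_independent]): an element of [C v] that is a sum of elements
    of [C w], none of the [w] above [v], lies in [phi v] and in the sum of these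
    [phi w], hence in the sum of the [phi (v meet w)], which is inside
    [below v].  Independence yields that [psi] preserves meets and that its
    smaller values are pure in the larger ones, being partial sums of a direct
    sum.  That [psi] preserves joins follows since [C w] is zero as soon as [w] is the
    join of two strictly smaller elements ([complement_eq0]).  So [C] is
    supported by the least element and the join-irreducible ones, without their
    having to be singled out.

    It remains to choose [C] large enough that [psi u] contains the meet of [H]
    and [phi u], which is finitely generated since the integers are noetherian
    ([noetherian]).  This is done from the top of [D] downwards
    ([exists_complements]): a finite set of elements of [phi u] to be covered
    lies in [below u + C u] for a suitable complement [C u], and the parts in
    [below u] are sums of finitely many elements of the [phi v] with [v < u],
    which are handed down to be covered at these [v]. *)

Set Implicit Arguments.
Unset Strict Implicit.
Unset Printing Implicit Defensive.

Import Order.TTheory GRing.Theory Num.Theory.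
Local Open Scope ring_scope.

(** * Spans of finite sequences *)

(** The generator zero is allowed, so that the zero ideal needs no separate
    treatment where this is used. *)
Lemma int_ideal_principal (I : int -> Prop) :
  I 0 -> (forall m n, I m -> I n -> I (m - n)) ->
  exists k : nat, I k /\ forall m, I m -> (k %| m)%Z.
Proof.
move=> I0 IB.
have IN m : I m -> I (- m) by move=> Im; rewrite -sub0r; exact: IB.
have ID m n : I m -> I n -> I (m + n).
  by move=> Im In; rewrite -[n]opprK; apply: IB => //; exact: IN.
have IMz m n : I m -> I (n * m).
  move=> Im; have IMn j : I (m *+ j).
    by elim: j => [|j IHj]; rewrite ?mulr0n ?mulrS //; exact: ID.
  rewrite mulrC -[n]intz mulrzr.
  by case: n => j; [exact: IMn | exact/IN/IMn].
have [[j [j0 Ij]]|noI] := pselect (exists j : nat, (0 < j)%N /\ I j); last first.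
  exists 0; split=> // m Im; have [-> //|m0] := eqVneq m 0.
  case: noI; exists `|m|%N; split; first by rewrite absz_gt0.
  by rewrite abszE normrEsign; exact: IMz.
have exP : exists j : nat, `[< (0 < j)%N /\ I j >] by exists j; apply/asboolP.
case: (ex_minnP exP) => k /asboolP[k0 Ik] kmin; exists k; split=> // m Im.
have Ir : I (m %% k)%Z by rewrite /modz; apply: IB => //; exact: IMz.
apply/dvdz_mod0P/eqP; apply: contraT => r0.
have k0' : Posz k != 0 by rewrite eqz_nat -lt0n.
have /kmin : `[< (0 < `|(m %% k)%Z|)%N /\ I `|(m %% k)%Z|%N >].
  by apply/asboolP; rewrite absz_gt0 gez0_abs ?modz_ge0.
by rewrite leqNgt -ltz_nat gez0_abs ?modz_ge0 ?ltz_pmod.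
Qed.

Section Spans.
Variable G : zmodType.
Implicit Types (A B K : subgroup G) (s t : seq G) (x y z : G).

Lemma subgroupMz A x (m : int) : carrier A x -> carrier A (x *~ m).
Proof.
move=> Ax; have AxMn n : carrier A (x *+ n).
  by elim: n => [|n IHn]; rewrite ?mulr0n ?mulrS;
    [exact: subgroup0 | exact: subgroupD].
by case: m => n; [exact: AxMn | exact/subgroupN/AxMn].
Qed.

Lemma joinP A B x :
  carrier (A `|` B)%O x <-> exists a b, [/\ carrier A a, carrier B b & x = a + b].
Proof.
rewrite join_subgroupE; split; first by case=> a Aa [b Bb <-]; exists a, b.
by case=> a [b [Aa Bb ->]]; exists a => //; exists b.
Qed.

Lemma mem_joinl A B x : carrier A x -> carrier (A `|` B)%O x.
Proof. by apply/le_subgroupP; exact: leUl. Qed.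

Lemma mem_joinr A B x : carrier B x -> carrier (A `|` B)%O x.
Proof. by apply/le_subgroupP; exact: leUr. Qed.

Fact multiples_closed x :
  `[< zmod_closed (mem [set y | exists m : int, y = x *~ m]%classic) >].
Proof.
apply/asboolP/zmod_closedP; split; first by exists 0; rewrite mulr0z.
by move=> _ _ [m ->] [n ->]; exists (m - n); rewrite mulrzBr.
Qed.

Definition multiples x : subgroup G := Subgroup (multiples_closed x).

(** Defined by recursion, so that the first generator can be split off; the
    base case [multiples 0] is the zero subgroup. *)
Definition spanz s : subgroup G :=
  foldr (fun x A => multiples x `|` A)%O (multiples 0) s.

Lemma spanz_nil x : carrier (spanz [::]) x -> x = 0.
Proof. by case=> m ->; rewrite mul0rz. Qed.

Lemma spanz_consP x s y : carrier (spanz (x :: s)) y <->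
  exists (m : int) z, carrier (spanz s) z /\ y = x *~ m + z.
Proof.
split; first by move/joinP=> [_ [z [[m ->] sz ->]]]; exists m, z.
by case=> m [z [sz ->]]; apply/joinP; exists (x *~ m), z; split=> //; exists m.
Qed.

Lemma mem_spanz s x : x \in s -> carrier (spanz s) x.
Proof.
elim: s => // y s IHs; rewrite inE => /predU1P[->|/IHs/mem_joinr]; last by apply.
by apply: mem_joinl; exists 1; rewrite mulr1z.
Qed.

Lemma le_spanz s A : (forall x, x \in s -> carrier A x) -> (spanz s <= A)%O.
Proof.
elim: s => [_|x s IHs sA].
  by apply/le_subgroupP => y /spanz_nil->; exact: subgroup0.
rewrite leUx IHs ?andbT => [|y ys]; last by apply: sA; rewrite inE ys orbT.
apply/le_subgroupP => _ [m ->]; apply: subgroupMz.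
by apply: sA; rewrite mem_head.
Qed.

Lemma spanz_nil_le A : (spanz [::] <= A)%O.
Proof. exact: le_spanz. Qed.

Lemma le_spanz_sub s t : {subset s <= t} -> (spanz s <= spanz t)%O.
Proof. by move=> st; apply: le_spanz => x /st/mem_spanz. Qed.

Lemma finitely_generatedP A : finitely_generated A <-> exists s, A = spanz s.
Proof.
have spanE s :
    carrier (spanz s) = smallest (fun X : set G => zmod_closed (mem X)) [set` s]%classic.
  apply/seteqP; split=> [x sx X [clX sX]|].
    have clX' : `[< zmod_closed (mem X) >] by apply/asboolP.
    have /le_subgroupP : (spanz s <= Subgroup clX')%O by apply: le_spanz => y /sX.
    exact.
  apply: smallest_sub; last by move=> x /= /mem_spanz.
  by apply/zmod_closedP; split; [exact: subgroup0 | exact: subgroupB].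
split=> -[s sE]; exists s; last by rewrite sE spanE.
by apply: eq_subgroup => x; rewrite sE spanE.
Qed.

Lemma spanz_shift x y s : carrier (spanz s) y -> spanz (x - y :: s) = spanz (x :: s).
Proof.
move=> sy; apply: le_anti; apply/andP; split; apply: le_spanz => z;
    rewrite inE => /predU1P[->|/mem_spanz/mem_joinr]; do ?by apply.
  by apply: subgroupB; [apply: mem_spanz; rewrite mem_head | exact: mem_joinr].
rewrite -[x](subrK y).
by apply: subgroupD; [apply: mem_spanz; rewrite subrK mem_head | exact: mem_joinr].
Qed.

(** Induction on the generators: the coefficients of the first one in elements
    of [A] form an ideal of the integers; an element of [A] whose coefficient
    generates it, together with the generators of the part of [A] in the span
    of the others, generate [A]. *)
Lemma noetherian A s : (A <= spanz s)%O -> exists t, A = spanz t.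
Proof.
elim: s A => [|x s IHs] A As.
  exists [::]; apply: eq_subgroup => y; split=> [|/spanz_nil->]; last exact: subgroup0.
  by move/le_subgroupP: As; apply.
have [t tE] := IHs (A `&` spanz s)%O (leIr _ _).
pose I (m : int) := exists2 z, carrier (spanz s) z & carrier A (x *~ m + z).
have [k [[z sz Az] kdvd]] : exists k : nat, I k /\ forall m, I m -> (k %| m)%Z.
  apply: int_ideal_principal => [|m n [y sy Ay] [z sz Az]].
    by exists 0; rewrite ?mulr0z ?addr0; exact: subgroup0.
  by exists (y - z); [|rewrite mulrzBr addrACA -opprD]; exact: subgroupB.
exists (x *~ k + z :: t); apply: le_anti; apply/andP; split; last first.
  rewrite /= leUx; apply/andP; split.
    by apply/le_subgroupP => _ [m ->]; exact: subgroupMz.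
  by rewrite -/(spanz t) -tE leIl.
apply/le_subgroupP => a Aa.
have /spanz_consP[m [y [sy aE]]] : carrier (spanz (x :: s)) a.
  by move/le_subgroupP: As; apply.
have /dvdzP[q mE] : (k %| m)%Z by apply: kdvd; exists y; rewrite -?aE.
apply/spanz_consP; exists q, (a - (x *~ k + z) *~ q).
split; last by rewrite addrC subrK.
rewrite -tE; split; first by apply: subgroupB => //; exact: subgroupMz.
rewrite aE mulrzDl -mulrzA mulrC -mE opprD addrACA subrr add0r.
by apply: subgroupB => //; exact: subgroupMz.
Qed.

End Spans.

(** * Splitting over a pure subgroup *)

Section PureComplement.
Variable G : zmodType.
Implicit Types (A B K : subgroup G) (s t : seq G) (x y z : G).

(** The divisibility step of the theory of elementary divisors.  The second
    hypothesis says that no relation modulo [A] between [n.+1] generators of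
    [K] over [A] has a positive head coefficient below [k]; here [A `|` spanz t]
    absorbs all the terms of the relation but the first.  Then in a relation
    with head coefficient [k] every other coefficient is a multiple of [k], and
    changing the head generator turns the relation into one for the head alone.
    The coefficients of the generators in [t1] have been cleared already. *)
Lemma divide_relation A K (n k : nat) :
    (0 < k)%N ->
    (forall x t r, size t = n -> (A `|` spanz (x :: t))%O = K ->
      carrier (A `|` spanz t)%O (x *+ r) -> (0 < r)%N -> (k <= r)%N) ->
  forall t2 t1 x y, size (t1 ++ t2) = n ->
    (A `|` spanz (x :: t1 ++ t2))%O = K ->
    carrier (spanz t2) y -> carrier A (x *+ k - y) ->
  exists x', (A `|` spanz (x' :: t1 ++ t2))%O = K /\ carrier A (x' *+ k).
Proof.
move=> k0 kmin; have kn0 : Posz k != 0 by rewrite eqz_nat -lt0n.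
elim=> [|z t2 IHt] t1 x y szt genK.
  by move=> /spanz_nil->; rewrite subr0 => Axk; exists x.
case/spanz_consP=> m [y2 [ty2 ->]].
rewrite (divz_eq m k); set q := (m %/ k)%Z => Axk.
have zt1 : carrier (spanz (t1 ++ z :: t2)) (z *~ q).
  by apply/subgroupMz/mem_spanz; rewrite mem_cat mem_head orbT.
have genK1 : (A `|` spanz (x - z *~ q :: t1 ++ z :: t2))%O = K.
  by rewrite spanz_shift.
have [r rE] : exists r : nat, (m %% k)%Z = r.
  by exists `|(m %% k)%Z|%N; rewrite gez0_abs ?modz_ge0.
have rk : (r < k)%N by rewrite -ltz_nat -rE ltz_pmod.
have {}Axk : carrier A ((x - z *~ q) *+ k - (z *+ r + y2)).
  suff -> : (x - z *~ q) *+ k - (z *+ r + y2)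
          = x *+ k - (z *~ (q * k + (m %% k)%Z) + y2) by [].
  rewrite rE mulrzDr mulrzA -!pmulrn mulrnBl !opprD !addrA.
  by [].
have [r0|r0] := posnP r.
  move: Axk; rewrite r0 mulr0n add0r => Axk.
  rewrite -cat_rcons in szt genK1 *; exact: IHt szt genK1 ty2 Axk.
(* A remainder [r > 0] would be the head coefficient of a relation for the
   same generators with [z] in front, contradicting minimality. *)
suff : (k <= r)%N by rewrite leqNgt rk.
set x1 := x - z *~ q in Axk genK1.
apply: (kmin z (x1 :: t1 ++ t2)) => //.
- by rewrite -szt /= !size_cat /= addnS.
- rewrite -genK1; congr (_ `|` _)%O; apply: le_anti; apply/andP.
  by split; apply: le_spanz_sub => w; rewrite !(inE, mem_cat);
     do 3?case: eqP => //=; case: (w \in t1).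
- apply/joinP; exists (- (x1 *+ k - (z *+ r + y2))), (x1 *+ k - y2); split.
  + exact: subgroupN.
  + apply: subgroupB; first by rewrite pmulrn; apply/subgroupMz/mem_spanz/mem_head.
    apply: mem_joinr; move: ty2; apply/le_subgroupP/le_spanz_sub => w wt2.
    by rewrite mem_cat wt2 orbT.
  + by rewrite opprB addrA subrK addrK.
Qed.

Lemma join_spanz_shift A x a t : carrier A a ->
  (A `|` spanz (x - a :: t))%O = (A `|` spanz (x :: t))%O.
Proof.
have half b w : carrier A b ->
    (A `|` spanz (w - b :: t) <= A `|` spanz (w :: t))%O.
  move=> Ab; rewrite leUx leUl; apply: le_spanz => z; rewrite inE.
  case/predU1P=> [->|tz]; last by apply/mem_joinr/mem_spanz; rewrite inE tz orbT.
  apply: subgroupB; last exact: mem_joinl.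
  exact/mem_joinr/mem_spanz/mem_head.
move=> Aa; apply: le_anti; rewrite half //=.
by have := half (- a) (x - a) (subgroupN Aa); rewrite opprK subrK.
Qed.

(** Induction on the number of generators.  A head generator [x] whose relations
    modulo [A] have the least possible positive head coefficient [k] can be
    changed into one with [x *+ k] in [A]; purity corrects it by an element of
    [A] to get [x *+ k = 0], and minimality of [k] shows that it is then
    independent of the other generators modulo [A].  If there is no relation
    with a nonzero head coefficient, any head generator will do. *)
Lemma pure_complement A B s : pure_in A B -> (spanz s <= B)%O ->
  exists c, (forall y, carrier (spanz c) y -> carrier A y -> y = 0) /\
            (A `|` spanz c)%O = (A `|` spanz s)%O.
Proof.
case=> leAB pureAB; have [n szs] : exists n, size s = n by exists (size s).
elim: n => [|n IHn] in s szs * => sB.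
  by exists s; split=> // y; rewrite (size0nil szs) => /spanz_nil.
set K := (A `|` spanz s)%O.
(* It suffices to find a head generator that is independent of the others
   modulo [A]: the induction hypothesis then applies to the latter. *)
suff [x [t [szt genK xord]]] : exists x t, [/\ size t = n,
    (A `|` spanz (x :: t))%O = K & forall m : int,
    carrier (A `|` spanz t)%O (x *~ m) -> x *~ m = 0].
  have tB : (spanz t <= B)%O.
    rewrite (@le_trans _ _ K) ?leUx ?leAB // -genK.
    by apply: le_trans (leUr _ _); exact: leUr.
  have [c [cA cE]] := IHn t szt tB.
  exists (x :: c); split; last first.
    by rewrite -genK /= !joinA ![(A `|` multiples x)%O]joinC -!joinA cE.
  move=> _ /spanz_consP[m [z [cz ->]]] Axz.
  have xm0 : x *~ m = 0.
    apply: xord; rewrite -cE -[x *~ m](addrK z).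
    by apply: subgroupB; [exact: mem_joinl | exact: mem_joinr].
  by move: Axz; rewrite xm0 add0r; exact: cA.
pose rel k := exists x t, [/\ size t = n, (A `|` spanz (x :: t))%O = K,
  carrier (A `|` spanz t)%O (x *+ k) & (0 < k)%N].
have [[k0 relk0]|norel] := pselect (exists k, rel k); last first.
  case: s szs @K sB @rel norel => // x t [szt] K sB rel norel.
  exists x, t; split=> // m xm; have [-> //|m0] := eqVneq m 0.
  case: norel; exists `|m|%N, x, t; split; rewrite ?absz_gt0 //.
  rewrite pmulrn abszE normrEsign mulrC mulrzA.
  exact: subgroupMz.
have exP : exists k, `[< rel k >] by exists k0; apply/asboolP.
case: (ex_minnP exP) => k /asboolP[x [t [szt genK xk k_gt0]]] kmin.
have kmin' x' t' r : size t' = n -> (A `|` spanz (x' :: t'))%O = K ->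
    carrier (A `|` spanz t')%O (x' *+ r) -> (0 < r)%N -> (k <= r)%N.
  by move=> *; apply: kmin; apply/asboolP; exists x', t'.
case/joinP: (xk) => a [y [Aa ty xkE]].
have Axk : carrier A (x *+ k - y) by rewrite xkE addrK.
have [x' [genK' Ax'k]] :=
  divide_relation k_gt0 kmin' (t1 := [::]) szt genK ty Axk.
have Bx' : carrier B x'.
  suff /le_subgroupP : (K <= B)%O.
    by apply; rewrite -genK'; exact/mem_joinr/mem_spanz/mem_head.
  by rewrite leUx leAB.
have [b Ab bk] := pureAB k x' Bx' Ax'k.
have genKb : (A `|` spanz (x' - b :: t))%O = K.
  by rewrite join_spanz_shift.
exists (x' - b), t; split=> // m xm.
have xbk : (x' - b) *+ k = 0 by rewrite mulrnBl bk subrr.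
have kn0 : Posz k != 0 by rewrite eqz_nat -lt0n.
have [r rE] : exists r : nat, (m %% k)%Z = r.
  by exists `|(m %% k)%Z|%N; rewrite gez0_abs ?modz_ge0.
have rk : (r < k)%N by rewrite -ltz_nat -rE ltz_pmod.
have xmE : (x' - b) *~ m = (x' - b) *+ r.
  by rewrite {1}(divz_eq m k) mulrzDr mulrC mulrzA -pmulrn xbk mul0rz add0r rE.
have [r0|r0] := posnP r; first by rewrite xmE r0 mulr0n.
by have := kmin' _ _ r szt genKb; rewrite -xmE => /(_ xm r0); rewrite leqNgt rk.
Qed.

End PureComplement.

(** * Sums of finite families of subgroups *)

Section FamilySums.
Variables (G : zmodType) (I : finType).
Implicit Types (A C : I -> subgroup G) (B : subgroup G) (P : pred I).

Fact family_sum_closed P A : `[< zmod_closed (mem [set x |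
  exists2 c : I -> G, forall i, carrier (A i) (c i) & x = \sum_(i | P i) c i]%classic) >].
Proof.
apply/asboolP/zmod_closedP; split.
  by exists (fun=> 0); [move=> i; exact: subgroup0 | rewrite big1].
move=> _ _ [c Ac ->] [e Ae ->]; exists (fun i => c i - e i); last by rewrite sumrB.
by move=> i; exact: subgroupB.
Qed.

Definition family_sum P A : subgroup G := Subgroup (family_sum_closed P A).

Lemma subgroup_sum B P (c : I -> G) :
  (forall i, P i -> carrier B (c i)) -> carrier B (\sum_(i | P i) c i).
Proof. by move=> Bc; apply: big_ind => //; [exact: subgroup0 | exact: subgroupD]. Qed.

Lemma family_sum_ge P A i : P i -> (A i <= family_sum P A)%O.
Proof.
move=> Pi; apply/le_subgroupP => x Ax; exists (fun j => if j == i then x else 0).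
  by move=> j; case: eqP => [->|_] //; exact: subgroup0.
by rewrite (bigD1 i) //= eqxx big1 ?addr0 // => j /andP[_ /negPf->].
Qed.

Lemma family_sum_le P A B :
  (forall i, P i -> (A i <= B)%O) -> (family_sum P A <= B)%O.
Proof.
move=> AB; apply/le_subgroupP => _ [c Ac ->]; apply: subgroup_sum => i Pi.
by have /le_subgroupP := AB i Pi; apply.
Qed.

Lemma family_sum_spanz P (s : I -> seq G) :
  family_sum P (fun i => spanz (s i)) = spanz (flatten [seq s i | i <- enum P]).
Proof.
apply: le_anti; apply/andP; split.
  apply: family_sum_le => i Pi; apply: le_spanz_sub => x six.
  by apply/flatten_mapP; exists i; rewrite ?mem_enum.
apply: le_spanz => x /flatten_mapP[i]; rewrite mem_enum => Pi six.
by have /le_subgroupP := family_sum_ge (fun i => spanz (s i)) Pi; apply; exact: mem_spanz.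
Qed.

(** The components along [A] of finitely many elements of a sum involve only
    finitely many elements of each [A i]. *)
Lemma split_generators P A B s : (spanz s <= family_sum P A `|` B)%O ->
  exists r : I -> seq G, [/\ forall i, (spanz (r i) <= A i)%O,
    forall i, ~~ P i -> r i = [::]
    & (spanz s <= family_sum P (fun i => spanz (r i)) `|` B)%O].
Proof.
elim: s => [_|x s IHs].
  exists (fun=> [::]); split=> // [i|]; exact: spanz_nil_le.
rewrite /= leUx => /andP[leX /IHs[r [rA rP rs]]].
have /joinP[_ [b [[c Ac ->] Bb xE]]] : carrier (family_sum P A `|` B)%O x.
  by move/le_subgroupP: leX; apply; exists 1; rewrite mulr1z.
exists (fun i => if P i then c i :: r i else [::]); split=> [i|i /negPf->//|].
- case: ifP => _; last exact: spanz_nil_le.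
  rewrite /= leUx rA andbT; apply/le_subgroupP => _ [m ->]; exact: subgroupMz.
- rewrite leUx; apply/andP; split.
    apply/le_subgroupP => _ [m ->]; apply: subgroupMz; rewrite xE.
    apply: subgroupD; last exact: mem_joinr.
    apply: mem_joinl; apply: subgroup_sum => i Pi.
    have /le_subgroupP := family_sum_ge
      (fun i => spanz (if P i then c i :: r i else [::])) Pi; apply.
    by rewrite Pi; exact/mem_spanz/mem_head.
  apply: le_trans rs _; apply: leU2 => //; apply: family_sum_le => i Pi.
  apply: le_trans (family_sum_ge _ Pi); rewrite Pi; exact: leUr.
Qed.

Definition independent A := forall c : I -> G,
  (forall i, carrier (A i) (c i)) -> \sum_i c i = 0 -> forall i, c i = 0.

Lemma independent_cap A P Q : independent A ->
  (family_sum P A `&` family_sum Q A <= family_sum (predI P Q) A)%O.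
Proof.
move=> indA; apply/le_subgroupP => x [[c Ac xc] [e Ae xe]].
pose f i := (if P i then c i else 0) - (if Q i then e i else 0).
have f0 : forall i, f i = 0.
  apply: indA => [i|]; last by rewrite sumrB -!big_mkcond /= -xc -xe subrr.
  by apply: subgroupB; case: ifP => // _; exact: subgroup0.
exists c => //; rewrite xc big_mkcond [RHS]big_mkcond; apply: eq_bigr => i _ /=.
by have := f0 i; rewrite /f; case: (P i) (Q i) => [] [] //; rewrite subr0.
Qed.

(** A partial sum of a direct sum is a direct summand of any larger one: a
    multiple of an element [b] that lies in it is that multiple of the
    projection of [b]. *)
Lemma independent_pure A P (Q : pred I) : independent A -> (forall i, P i -> Q i) ->
  pure_in (family_sum P A) (family_sum Q A).
Proof.
move=> indA PQ; split; first by apply: family_sum_le => i /PQ; exact: family_sum_ge.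
move=> n _ [c Ac ->] [e Ae bE].
pose f i := (if Q i then c i *+ n else 0) - (if P i then e i else 0).
have f0 : forall i, f i = 0.
  apply: indA => [i|]; last by rewrite sumrB -!big_mkcond /= -bE sumrMnl subrr.
  by apply: subgroupB; case: ifP => // _; rewrite ?pmulrn;
    do ?exact: subgroupMz; exact: subgroup0.
exists (\sum_(i | P i) c i); first by exists c.
rewrite bE -sumrMnl; apply: eq_bigr => i Pi.
by have := f0 i; rewrite /f Pi (PQ i Pi) => /eqP; rewrite subr_eq0 => /eqP.
Qed.

End FamilySums.

(** * Complements of the lower sums *)

Section Approximation.
Variables (d : Order.disp_t) (D : finDistrLatticeType d) (G : zmodType).
Variable phi : {lmorphism D -> subgroup G}.
Implicit Types (u v w : D) (C : D -> subgroup G).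

Definition below u : subgroup G := family_sum (fun v => v < u)%O phi.

Lemma exists_maximal (P : pred D) v0 :
  P v0 -> exists2 v, P v & forall w, P w -> ~~ (v < w)%O.
Proof.
pose height v := #|[pred w | (w <= v)%O]|.
move=> Pv0; case: (@arg_maxnP _ v0 P height Pv0) => v Pv vmax; exists v => // w.
move=> /vmax; apply: contraL => vw; rewrite -ltnNge.
apply: proper_card; apply/properP; split.
  by apply/fintype.subsetP => z; rewrite !inE => /le_trans; apply; exact: ltW.
by exists w; rewrite !inE ?lexx // lt_geF.
Qed.

(** Stands for the join of the elements of [P]; to iterate joins one would start
    from a least element, which an empty [D] does not have. *)
Lemma upper_bound_in (Q : D -> Prop) (P : pred D) v0 :
    P v0 -> (forall v, P v -> Q v) ->
    (forall v w, Q v -> Q w -> Q (v `|` w)%O) ->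
  exists2 w, Q w & forall v, P v -> (v <= w)%O.
Proof.
move=> Pv0 PQ QU.
suff [w [Qw lew]] : exists w, Q w /\ forall v, v \in enum P -> (v <= w)%O.
  by exists w => // v Pv; apply: lew; rewrite mem_enum.
have : all P (enum P) by apply/allP => v; rewrite mem_enum.
elim: (enum P) => [_|v s IHs /= /andP[Pv /IHs[w [Qw lew]]]].
  by exists v0; split=> //; exact: PQ.
exists (v `|` w)%O; split; first by apply: QU => //; exact: PQ.
by move=> z; rewrite inE => /predU1P[->|/lew zw]; rewrite ?leUl // (le_trans zw) ?leUr.
Qed.

Lemma phi_mono : {homo phi : u v / (u <= v)%O}.
Proof. exact: omorph_le. Qed.

Lemma below_le u : (below u <= phi u)%O.
Proof. by apply: family_sum_le => v vu; apply/phi_mono/ltW. Qed.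

(** For [u] minimal, [below u] is an empty sum, hence zero, and the zero subgroup
    is pure; otherwise it is a value of [phi]. *)
Lemma pure_below u : purity_condition phi -> pure_in (below u) (phi u).
Proof.
move=> pure_phi; have [[v0 v0u]|min_u] := pselect (exists v, v < u)%O.
  have [w /andP[wu phiw] lew] : exists2 w, (w <= u)%O && (phi w <= below u)%O
      & forall v, (v < u)%O -> (v <= w)%O.
    apply: (@upper_bound_in _ (fun v => v < u)%O v0) => // [v vu|v w].
      rewrite ltW //=; exact: (@family_sum_ge _ _ (fun v => v < u)%O phi).
    by move=> /andP[vu pv] /andP[wu pw]; rewrite omorphU !leUx vu wu pv pw.
  suff -> : below u = phi w by exact: pure_phi.
  apply: le_anti; rewrite phiw andbT; apply: family_sum_le => v /lew.
  exact: phi_mono.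
split; first exact: below_le.
move=> n b _ [c _ bE]; exists 0; first exact: subgroup0.
by rewrite mul0rn bE big_pred0 // => v; apply/negP => vu; apply: min_u; exists v.
Qed.

(** By distributivity [phi v] meets this sum in the sum of the subgroups
    [phi (v `&` w)], and [v `&` w < v] when [v] is not below [w]. *)
Lemma cap_below v (P : pred D) : (forall w, P w -> ~~ (v <= w)%O) ->
  (phi v `&` family_sum P phi <= below v)%O.
Proof.
move=> vP; have [[w0 Pw0]|P0] := pselect (exists w, P w); last first.
  apply: le_trans (leIr _ _) _; apply: family_sum_le => w Pw.
  by case: P0; exists w.
have [w wv lew] : exists2 w, (phi (v `&` w) <= below v)%O
    & forall w', P w' -> (w' <= w)%O.
  apply: (@upper_bound_in _ P w0) => // [w Pw|w w' ww ww'].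
    apply: (@family_sum_ge _ _ (fun v' => v' < v)%O phi).
    by rewrite lt_leAnge leIl lexI lexx /= vP.
  by rewrite meetUr omorphU leUx ww.
apply: le_trans wv; rewrite omorphI; apply: leI2 => //.
by apply: family_sum_le => w' /lew; exact: phi_mono.
Qed.

(** In a vanishing sum look at a maximal index [v] with nonzero term: the other
    nonzero terms have indices not above [v], so [cap_below] puts the term at
    [v] in [below v]. *)
Lemma complements_independent C : (forall u, (C u <= phi u)%O) ->
  (forall u x, carrier (C u) x -> carrier (below u) x -> x = 0) -> independent C.
Proof.
move=> Cphi Cbelow c Cc sum0; suff noc : forall v, ~~ (c v != 0).
  by move=> v; apply/eqP; rewrite -[_ == _]negbK.
move=> v1; apply/negP => cv1.
have [v cv0 vmax] := @exists_maximal (fun v => c v != 0) v1 cv1.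
move/eqP: cv0; apply; apply: Cbelow (Cc v) _.
pose P w := (w != v) && (c w != 0).
have vP w : P w -> ~~ (v <= w)%O.
  by case/andP=> wv /vmax; rewrite lt_neqAle eq_sym wv.
have /le_subgroupP := cap_below vP; apply; split.
  by have /le_subgroupP := Cphi v; apply.
have -> : c v = - \sum_(w | P w) c w.
  apply/eqP; rewrite -addr_eq0; apply/eqP; rewrite -[RHS]sum0.
  rewrite [RHS](bigD1 v) //=; congr (_ + _); rewrite [RHS](bigID (fun w => c w != 0)) /=.
  by rewrite [X in _ + X]big1 ?addr0 // => w /andP[_ /negbNE/eqP].
apply: subgroupN; apply: subgroup_sum => w Pw.
have /le_subgroupP := family_sum_ge (fun w => phi w) Pw; apply.
by have /le_subgroupP := Cphi w; apply.
Qed.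

(** Here [w] is the join of its meets with [u] and [v], both strictly smaller,
    so [below w] is the whole of [phi w]. *)
Lemma complement_eq0 C u v w x : (C w <= phi w)%O ->
    (forall x, carrier (C w) x -> carrier (below w) x -> x = 0) ->
  (w <= u `|` v)%O -> ~~ (w <= u)%O -> ~~ (w <= v)%O -> carrier (C w) x -> x = 0.
Proof.
move=> Cphi Cbelow wuv wu wv Cx; apply: (Cbelow) (Cx) _.
have lt_meet z : ~~ (w <= z)%O -> (phi (w `&` z) <= below w)%O.
  move=> wz; apply: (@family_sum_ge _ _ (fun v => v < w)%O phi).
  by rewrite lt_leAnge leIl lexI lexx.
suff /le_subgroupP : (C w <= below w)%O by apply.
apply: le_trans Cphi _; rewrite -[w in phi w](meet_idPl wuv) meetUr omorphU leUx.
by rewrite !lt_meet.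
Qed.

Lemma complements_join C u v : (forall u, (C u <= phi u)%O) ->
  (forall u x, carrier (C u) x -> carrier (below u) x -> x = 0) ->
  (family_sum (fun w => w <= u `|` v) C
   = family_sum (fun w => w <= u) C `|` family_sum (fun w => w <= v) C)%O.
Proof.
move=> Cphi Cbelow; apply: le_anti; apply/andP; split; last first.
  rewrite leUx; apply/andP; split; apply: family_sum_le => w wle;
    apply: (@family_sum_ge _ _ (fun w => w <= u `|` v)%O C).
    exact: le_trans wle (leUl _ _).
  exact: le_trans wle (leUr _ _).
apply: family_sum_le => w wuv.
have [wu|wu] := boolP (w <= u)%O.
  apply: le_trans (leUl _ _); exact: (@family_sum_ge _ _ (fun w => w <= u)%O C).
have [wv|wv] := boolP (w <= v)%O.
  apply: le_trans (leUr _ _); exact: (@family_sum_ge _ _ (fun w => w <= v)%O C).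
apply/le_subgroupP => x Cx.
rewrite (complement_eq0 (Cphi w) (Cbelow w) wuv wu wv Cx); exact: subgroup0.
Qed.

(** [T u] lists elements of [phi u] that have to be covered.  The induction
    removes a maximal element [u] of the down-set [S]: a complement at [u] takes
    care of [T u] up to elements of [below u], and the components [r v] of the
    latter join the lists [T v] for [v < u], all in [S]. *)
Lemma exists_complements (S : {set D}) (T : D -> seq G) :
    purity_condition phi ->
    (forall u v, (u <= v)%O -> v \in S -> u \in S) ->
    (forall u, (spanz (T u) <= phi u)%O) ->
    (forall u, u \notin S -> T u = [::]) ->
  exists C : D -> seq G, [/\ forall u, u \notin S -> C u = [::],
    forall u, (spanz (C u) <= phi u)%O,
    forall u x, carrier (spanz (C u)) x -> carrier (below u) x -> x = 0
    & forall u, (spanz (T u) <=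
        family_sum (fun v => v <= u) (fun v => spanz (C v)))%O].
Proof.
move=> pure_phi; have [n] := ubnP #|S|.
elim: n S T => // n IHn S T leSn downS Tphi TS.
have [S0|[u1 u1S]] := set_0Vmem S.
  exists (fun=> [::]); split=> // [u|u x|u].
  - exact: spanz_nil_le.
  - by move/spanz_nil.
  - by rewrite TS; [exact: spanz_nil_le | rewrite S0 finset.in_set0].
have [u uS umax] := @exists_maximal (fun v => v \in S) u1 u1S.
have [c [cbelow cE]] := pure_complement (pure_below u pure_phi) (Tphi u).
have [r [rphi r0 rT]] : exists r : D -> seq G, [/\
    forall v, (spanz (r v) <= phi v)%O, forall v, ~~ (v < u)%O -> r v = [::]
    & (spanz (T u) <= family_sum (fun v => v < u) (fun v => spanz (r v))
                      `|` spanz c)%O].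
  by apply: split_generators; rewrite -/(below u) cE leUr.
pose T' v := if v == u then [::] else T v ++ r v.
have [||v|v|C [C0 Cphi Cbelow CT]] := IHn (S :\ u) T'.
- by move: leSn; rewrite (cardsD1 u) uS.
- move=> v w vw; rewrite !inE => /andP[wu wS]; rewrite (downS _ _ vw wS) andbT.
  apply: contra_neq wu => vu; apply/eqP; move: (umax w wS).
  by rewrite lt_neqAle -vu vw andbT negbK vu eq_sym.
- rewrite /T'; case: eqP => _; apply: le_spanz => x //.
  by rewrite mem_cat => /orP[] /mem_spanz; apply/le_subgroupP;
    [exact: Tphi | exact: rphi].
- rewrite !inE negb_and negbK /T'; case: eqP => //= _ vS.
  rewrite TS // r0 //; apply: contra vS => /ltW vu; exact: downS vu uS.
pose C' v := if v == u then c else C v.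
have C'u : C' u = c by rewrite /C' eqxx.
have C'v v : v != u -> C' v = C v by rewrite /C' => /negPf->.
have Cle w : (spanz (C w) <= spanz (C' w))%O.
  case: (eqVneq w u) => [->|/C'v-> //].
  by rewrite C0; [exact: spanz_nil_le | rewrite !inE eqxx].
have CC' v w : (v <= w)%O ->
    (family_sum (fun z => z <= v) (fun z => spanz (C z)) <=
     family_sum (fun z => z <= w) (fun z => spanz (C' z)))%O.
  move=> vw; apply: family_sum_le => z zv; apply: le_trans (Cle z) _.
  apply: (@family_sum_ge _ _ (fun z => z <= w)%O (fun z => spanz (C' z))).
  exact: le_trans zv vw.
exists C'; split=> [v vS|v|v x|v]; have [vu|vu] := eqVneq v u;
  rewrite ?(C'v _ vu) ?vu //.
- by rewrite -vu (negPf vS) in uS.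
- by apply: C0; rewrite !inE (negPf vS) andbF.
- rewrite C'u; apply: le_trans (leUr _ (below u)) _.
  by rewrite cE leUx below_le Tphi.
- by rewrite C'u; exact: cbelow.
- exact: Cbelow.
- apply: le_trans rT _; rewrite leUx; apply/andP; split.
    apply: family_sum_le => w wu; apply: le_trans (CC' w u (ltW wu)).
    apply: le_trans (CT w); rewrite /T' lt_eqF //; apply: le_spanz_sub => x.
    by rewrite mem_cat orbC => ->.
  rewrite -C'u.
  exact: (@family_sum_ge _ _ (fun z => z <= u)%O (fun z => spanz (C' z))).
- apply: le_trans (CC' v v (lexx v)).
  apply: le_trans (CT v); rewrite /T' (negPf vu); apply: le_spanz_sub => x.
  by rewrite mem_cat => ->.
Qed.

End Approximation.

(** * The approximation theorem *)

Theorem theorem5p4 (d : Order.disp_t) (D : finDistrLatticeType d)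
    (G : zmodType) (phi : {lmorphism D -> subgroup G}) :
  purity_condition phi -> purely_finitely_approximated phi.
Proof.
move=> pure_phi H /finitely_generatedP[h HE].
have /choice[T TE] u : exists t, (H `&` phi u)%O = spanz t.
  by apply: (@noetherian _ _ h); rewrite -HE leIl.
have [|u|u|C [_ Cphi Cbelow CT]] :=
  @exists_complements _ D G phi [set: D]%SET T pure_phi.
- by move=> *; rewrite finset.in_setT.
- by rewrite -TE leIr.
- by rewrite finset.in_setT.
pose C' u := spanz (C u).
have indC : independent C' by exact: complements_independent Cphi Cbelow.
pose psi (u : D) := family_sum (fun w => w <= u)%O C'.
have psi_le u v : (u <= v)%O -> (psi u <= psi v)%O.
  move=> uv; apply: family_sum_le => w wu.
  exact/(@family_sum_ge _ _ (fun w => w <= v)%O C')/(le_trans wu uv).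
have psiI : Order.meet_morphism psi.
  move=> u v; apply: le_anti; apply/andP; split.
    by rewrite lexI !psi_le ?leIl ?leIr.
  apply: le_trans (independent_cap _ _ indC) _.
  apply: family_sum_le => w /andP[wu wv].
  by apply: (@family_sum_ge _ _ (fun w => w <= u `&` v)%O C'); rewrite lexI wu.
have psiU : Order.join_morphism psi.
  by move=> u v; exact: complements_join Cphi Cbelow.
pose psiOM := Order.isOrderMorphism.Build _ D _ (subgroup G) psi psi_le.
pose psiO : {omorphism D -> subgroup G} := HB.pack psi psiOM.
pose psiLM := Order.isLatticeMorphism.Build _ D _ (subgroup G) psiO psiI psiU.
pose psiL : {lmorphism D -> subgroup G} := HB.pack psi psiOM psiLM.
exists psiL; split.
  move=> u v uv; apply: independent_pure => // w wu; exact: le_trans uv.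
move=> u; split.
  by apply/finitely_generatedP; eexists; exact: family_sum_spanz.
rewrite TE CT /=; apply: family_sum_le => w wu.
by apply: le_trans (Cphi w) _; exact: phi_mono.
Qed.
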